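(* Let $d\ge 2$ be an integer and $\alpha>-\frac12$ a real number. The uncentered maximal operator $M_\alpha$ associated with the Weinstein operator is of weak type $(1,1)$: there exists a constant $c>0$ such that for every $f\in L^1(\mathbb{R}^d_+,\nu_\alpha)$ and every $\lambda>0$, $$\nu_\alpha\big(\{x\in\mathbb{R}^d_+ : M_\alpha f(x)>\lambda\}\big)\le c\,\frac{\|f\|_{1,\alpha}}{\lambda}.$$
   Context: $\mathbb{R}^d_+=\mathbb{R}^{d-1}\times(0,+\infty)$; points are written $x=(x',x_d)$ with $x'=(x_1,\dots,x_{d-1})\in\mathbb{R}^{d-1}$, $x_d>0$; $\|\cdot\|$ is the Euclidean norm. The measure $\nu_\alpha$ on $\mathbb{R}^d_+$ is $$d\nu_\alpha(x)=\frac{x_d^{2\alpha+1}}{(2\pi)^{\frac{d-1}{2}}2^\alpha\Gamma(\alpha+1)}\,dx,$$ where $dx$ is Lebesgue measure, and $\|f\|_{1,\alpha}=\int_{\mathbb{R}^d_+}|f|\,d\nu_\alpha$. For $\varepsilon>0$ and a point $x\in\mathbb{R}^d_+$ or $x=0$, $B^+(x,\varepsilon)=B(x,\varepsilon)\cap\mathbb{R}^d_+$, where $B(x,\varepsilon)$ is the closed Euclidean ball of $\mathbb{R}^d$ with center $x$ and radius $\varepsilon$; $\chi_A$ is the characteristic function of $A$. For $x_d,y_d,\rho>0$ let $$W_\alpha(x_d,y_d,\rho)=\frac{\Gamma(\alpha+1)\,\big((x_d+y_d)^2-\rho^2\big)^{\alpha-\frac12}\big(\rho^2-(x_d-y_d)^2\big)^{\alpha-\frac12}}{2^{2\alpha-1}\sqrt{\pi}\,\Gamma(\alpha+\frac12)\,(x_dy_d\rho)^{2\alpha}}$$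 if $|x_d-y_d|<\rho<x_d+y_d$, and $W_\alpha(x_d,y_d,\rho)=0$ otherwise. The Weinstein translation of $\chi_{B^+(0,\varepsilon)}$ by $x\in\mathbb{R}^d_+$ is given, for $y=(y',y_d)\in\mathbb{R}^d_+$, by $$\tau_x(\chi_{B^+(0,\varepsilon)})(-y',y_d)=\int_0^{+\infty}\chi_{B^+(0,\varepsilon)}(x'-y',\rho)\,W_\alpha(x_d,y_d,\rho)\,\rho^{2\alpha+1}\,d\rho.$$ The uncentered maximal function of $f$ is, for $x\in\mathbb{R}^d_+$, $$M_\alpha f(x)=\sup_{\varepsilon>0,\;z\in B^+(x,\varepsilon)}\frac{1}{\nu_\alpha(B^+(0,\varepsilon))}\left|\int_{\mathbb{R}^d_+}f(y)\,\tau_z(\chi_{B^+(0,\varepsilon)})(-y',y_d)\,d\nu_\alpha(y)\right|.$$ *)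

(* Defs.v *)
From HB Require Import structures.
From mathcomp Require Import all_boot all_order all_algebra.
From mathcomp Require Import all_classical all_reals all_analysis.
From mathcomp Require Import measurable_realfun.

Set Implicit Arguments.
Unset Strict Implicit.
Unset Printing Implicit Defensive.

Import Order.TTheory GRing.Theory Num.Theory.
Import numFieldNormedType.Exports.

Local Open Scope classical_set_scope.
Local Open Scope ring_scope.

Definition tuple_cons {T : Type} {n : nat} (xu : T * n.-tuple T) :
  n.+1.-tuple T := [tuple of xu.1 :: xu.2].

(* Lebesgue measure on the Borel sets of R^n, with R^n represented by n-tuples
   equipped with the product sigma-algebra. It is built from the product
   measure by recursion on n; R^0 is a point of mass 1. *)
Fixpoint lebesgue_tuple (R : realType) (n : nat) :
    set (n.-tuple R) -> \bar R :=
  match n with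
  | 0 => \d_([tuple] : 0.-tuple R)
  | m.+1 => pushforward
              (@lebesgue_measure R \x lebesgue_tuple (R := R) (n := m))%E
              tuple_cons
  end.

Section lebesgue_tuple_measure.
Context (R : realType).
Local Notation leb := (@lebesgue_measure R).

Let measurable_tuple_cons n : measurable_fun [set: R * n.-tuple R] tuple_cons.
Proof. exact: measurable_cons. Qed.

Let lebesgue_tuple_bundled n :
  exists m : {sigma_finite_measure set (n.-tuple R) -> \bar R},
    lebesgue_tuple (R := R) (n := n) = m.
Proof.
elim: n => [|n [m mE]].
  by exists (\d_([tuple] : 0.-tuple R)).
pose Q : {measure set (n.+1.-tuple R) -> \bar R} :=
  measure_function_pushforward__canonical__measure_function_Measure
    (leb \x m)%E (@measurable_tuple_cons n).
have QE : lebesgue_tuple (R := R) (n := n.+1) = Q by rewrite /= mE.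
have sQ : sigma_finite setT Q.
  have /sigma_finiteP[F [TF ndF Foo]] := sigma_finiteT leb.
  have /sigma_finiteP[G [TG ndG Goo]] := sigma_finiteT m.
  pose g (t : n.+1.-tuple R) : (R * n.-tuple R)%type :=
    (thead t, [tuple of behead t]).
  have mg : measurable_fun setT g.
    apply/measurable_fun_pairP; split; first exact: measurable_tnth.
    exact: measurable_behead.
  have gK (p : (R * n.-tuple R)%type) : g (tuple_cons p) = p.
    by case: p => a b; congr pair; apply/val_inj.
  exists (fun i => g @^-1` (F i `*` G i)).
    apply/esym; rewrite -subTset => t _.
    have [i _ Fi] : (\bigcup_k F k) (g t).1 by rewrite -TF.
    have [j _ Gj] : (\bigcup_k G k) (g t).2 by rewrite -TG.
    exists (maxn i j) => //; split.
      by move: Fi; exact/subsetPset/ndF/leq_maxl.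
    by move: Gj; exact/subsetPset/ndG/leq_maxr.
  move=> i; have [mF Fi] := Foo i; have [mG Gi] := Goo i; split.
    by rewrite -[X in measurable X]setTI; apply: mg => //; exact: measurableX.
  have -> : Q (g @^-1` (F i `*` G i)) = (leb \x m)%E (F i `*` G i).
    rewrite /Q/= /pushforward -comp_preimage.
    by rewrite (_ : g \o tuple_cons = id)//; apply/funext => p; exact: gK.
  by rewrite product_measure1E// lte_mul_pinfty// ge0_fin_numE.
pose S := Measure_isSigmaFinite.Build _ _ _ Q sQ.
pose Q' : {sigma_finite_measure set (n.+1.-tuple R) -> \bar R} :=
  HB.pack (Measure.sort Q) (Measure.class Q) S.
by exists Q'.
Qed.

Let lebesgue_tuple0 n : lebesgue_tuple (R := R) (n := n) set0 = 0%E.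
Proof. by have [m ->] := lebesgue_tuple_bundled n; exact: measure0. Qed.

Let lebesgue_tuple_ge0 n A : (0 <= lebesgue_tuple (R := R) (n := n) A)%E.
Proof. by have [m ->] := lebesgue_tuple_bundled n; exact: measure_ge0. Qed.

Let lebesgue_tuple_sigma_additive n :
  semi_sigma_additive (lebesgue_tuple (R := R) (n := n)).
Proof.
by have [m ->] := lebesgue_tuple_bundled n; exact: measure_semi_sigma_additive.
Qed.

HB.instance Definition _ n := isMeasure.Build _ _ _
  (lebesgue_tuple (R := R) (n := n))
  (lebesgue_tuple0 n) (@lebesgue_tuple_ge0 n)
  (@lebesgue_tuple_sigma_additive n).

Let lebesgue_tuple_sigma_finite n :
  sigma_finite setT (lebesgue_tuple (R := R) (n := n)).
Proof. by have [m ->] := lebesgue_tuple_bundled n; exact: sigma_finiteT. Qed.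

HB.instance Definition _ n := Measure_isSigmaFinite.Build _ _ _
  (lebesgue_tuple (R := R) (n := n)) (lebesgue_tuple_sigma_finite n).

End lebesgue_tuple_measure.

Definition Gamma (R : realType) (a : R) : R :=
  \int[@lebesgue_measure R]_(t in `]0, +oo[) (t `^ (a - 1) * expR (- t)).

(* For d >= 1, a point x = (x', x_d) of R^d is the pair of x' in R^(d-1) and
   x_d in R; its components are x.1 and x.2. *)
Definition Rd (R : realType) (d : nat) : Type := ((d.-1).-tuple R * R)%type.

Section euclidean.
Context (R : realType) (d : nat).
Implicit Types x y : Rd R d.

Definition lebesgue_Rd : set (Rd R d) -> \bar R :=
  (lebesgue_tuple (R := R) (n := d.-1) \x @lebesgue_measure R)%E.

Let lebesgue_Rd0 : lebesgue_Rd set0 = 0%E.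
Proof.
exact: (@measure0 _ _ _ (lebesgue_tuple (n := d.-1) \x lebesgue_measure)%E).
Qed.

Let lebesgue_Rd_ge0 A : (0 <= lebesgue_Rd A)%E.
Proof.
exact: (@measure_ge0 _ _ _ (lebesgue_tuple (n := d.-1) \x lebesgue_measure)%E).
Qed.

Let lebesgue_Rd_sigma_additive : semi_sigma_additive lebesgue_Rd.
Proof.
exact: (@measure_semi_sigma_additive _ _ _
  (lebesgue_tuple (n := d.-1) \x lebesgue_measure)%E).
Qed.

HB.instance Definition _ := isMeasure.Build _ _ _ lebesgue_Rd
  lebesgue_Rd0 lebesgue_Rd_ge0 lebesgue_Rd_sigma_additive.

Definition origin : Rd R d := ([tuple 0 | i < d.-1], 0).

Definition edist x y : R :=
  Num.sqrt (\sum_(i < d.-1) (tnth x.1 i - tnth y.1 i) ^+ 2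
            + (x.2 - y.2) ^+ 2).

Definition halfspace : set (Rd R d) := [set x | 0 < x.2].

Definition ball_plus x (eps : R) : set (Rd R d) :=
  [set y | edist x y <= eps] `&` halfspace.

(* (y', y_d) |-> (- y', y_d) *)
Definition flip_horizontal y : Rd R d := ([tuple - tnth y.1 i | i < d.-1], y.2).

End euclidean.
Arguments origin {R d}.
Arguments halfspace {R d}.

Section weinstein_measure.
Context (R : realType) (d : nat) (alpha : R).

Definition nu_density (x : Rd R d) : R :=
  x.2 `^ (2 * alpha + 1) /
  ((2 * pi) `^ ((d%:R - 1) / 2) * 2 `^ alpha * Gamma (alpha + 1)).

(* nu_alpha is seen as a measure on R^d carried by the open half-space, where
   x_d > 0, so the power x_d `^ (2 * alpha + 1) is the usual one there. *)
Definition nu (A : set (Rd R d)) : \bar R :=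
  \int[@lebesgue_Rd R d]_(x in A `&` halfspace) (nu_density x)%:E.

Let nu_density_ge0 x : 0 <= nu_density x.
Proof.
rewrite /nu_density divr_ge0 ?mulr_ge0 ?powR_ge0//.
by apply: Rintegral_ge0 => t _; rewrite mulr_ge0 ?powR_ge0 ?expR_ge0.
Qed.

Let measurable_nu_density : measurable_fun [set: Rd R d] (EFin \o nu_density).
Proof.
apply/measurable_EFinP; apply: measurable_funM => //.
by apply: (measurableT_comp (measurable_powR _)).
Qed.

Let measurable_halfspace : measurable (@halfspace R d).
Proof.
rewrite (_ : halfspace = setT `&` snd @^-1` `]0, +oo[); last first.
  by rewrite setTI; apply/seteqP; split=> x /=; rewrite in_itv/= andbT.
exact: measurable_snd.
Qed.

Let nu0 : nu set0 = 0%E.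
Proof. by rewrite /nu set0I integral_set0. Qed.

Let nu_ge0 A : (0 <= nu A)%E.
Proof. by apply: integral_ge0 => x _; rewrite lee_fin. Qed.

Let nu_sigma_additive : semi_sigma_additive nu.
Proof.
move=> F mF tF mUF; rewrite /nu setI_bigcupl ge0_integral_bigcup//=.
- by apply: is_cvg_ereal_nneg_natsum_cond => n _ _; exact: nu_ge0.
- by move=> k; exact: measurableI.
- by apply: measurable_funS measurable_nu_density.
- by move=> x _; rewrite lee_fin.
- exact: trivIset_setIr.
Qed.

HB.instance Definition _ := isMeasure.Build _ _ _ nu
  nu0 nu_ge0 nu_sigma_additive.

End weinstein_measure.

Section maximal_function.
Context (R : realType) (d : nat) (alpha : R).
Implicit Types (f g : Rd R d -> R) (x y z : Rd R d).

(* W_alpha(s, t, rho), to be used for s, t, rho > 0 only: all the bases of real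
   powers are then positive in the first branch. *)
Definition weinstein_kernel (s t rho : R) : R :=
  if (`|s - t| < rho) && (rho < s + t) then
    Gamma (alpha + 1)
      * ((s + t) ^+ 2 - rho ^+ 2) `^ (alpha - 2^-1)
      * (rho ^+ 2 - (s - t) ^+ 2) `^ (alpha - 2^-1)
    / (2 `^ (2 * alpha - 1) * Num.sqrt pi * Gamma (alpha + 2^-1)
       * (s * t * rho) `^ (2 * alpha))
  else 0.

(* tau_x(g)(y) is the integral over rho > 0 of
   g(x' + y', rho) W_alpha(x_d, y_d, rho) rho^(2 alpha + 1); at the reflected
   point (- y', y_d) the argument of g becomes (x' - y', rho). *)
Definition weinstein_translation x g y : R :=
  \int[@lebesgue_measure R]_(rho in `]0, +oo[)
    (g ([tuple tnth x.1 i + tnth y.1 i | i < d.-1], rho)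
     * weinstein_kernel x.2 y.2 rho * rho `^ (2 * alpha + 1)).

Definition maximal_function f x : \bar R :=
  ereal_sup [set r | exists eps z,
    [/\ 0 < eps, ball_plus x eps z &
      r = ((nu alpha (@ball_plus R d origin eps))^-1 *
           `| \int[@nu R d alpha]_(y in halfspace)
               (f y * weinstein_translation z \1_(ball_plus origin eps)
                        (flip_horizontal y))%:E |)%E]].

Definition norm1 f : \bar R :=
  \int[@nu R d alpha]_(x in halfspace) `|f x|%:E.

End maximal_function.

(* Main.v *)
Require Import Defs.
From HB Require Import structures.
From mathcomp Require Import all_boot all_order all_algebra.
From mathcomp Require Import all_classical all_reals all_analysis.
From mathcomp Require Import measurable_realfun.
From mathcomp Require Import ring lra.

Set Implicit Arguments.
Unset Strict Implicit.
Unset Printing Implicit Defensive.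

Import Order.TTheory GRing.Theory Num.Theory.
Import numFieldNormedType.Exports.

Local Open Scope classical_set_scope.
Local Open Scope ring_scope.

(** The Weinstein translation of the characteristic function of a half-ball is
    dominated by a multiple of the characteristic function of a cube, and this
    reduces the theorem to the Vitali covering argument for a doubling measure.

    Write p = 2 alpha + 1 > 0 and let V(z, eps) = eps^d (z_d + eps)^p, which is
    the size, up to constants, of the nu-measure of the cube Q(z, eps) of centre
    z and half-side eps, cut by the half-space. The translation tau_z of the
    characteristic function of B+(0, eps) vanishes outside Q(z, eps), because
    W_alpha(z_d, y_d, rho) forces |z_d - y_d| < rho and the half-ball forces
    |z' - y'| <= eps and rho <= eps. Its values are at most
    C (eps / (z_d + eps))^p (weinstein_translation_le): with s = z_d, t = y_d,
    a = |s - t| and e = s + t, the weight W_alpha(s, t, rho) rho^p is at most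
    the beta density (e - rho)^b (rho - a)^b with b = alpha - 1/2 > -1, times
    factors that are constant in rho, and the integral of this density over
    (a, min (e, 2 eps)) is bounded by elementary means. As nu (B+(0, eps)) is at least a constant
    times eps^(d + p), the averages which define the maximal function are at
    most C / V(z, eps) times the integral of |f| over Q(z, eps)
    (maximal_function_sup_ball).

    Enlarging the cubes by a bounded factor makes their centres and half-sides
    rational, so that the set where the maximal function exceeds lambda is
    covered by countably many cubes Q_i with
    nu (3 Q_i) <= (c / lambda) int_(Q_i) |f| (maximal_function_covering). For
    finitely many of them, keeping a largest cube, discarding the cubes that
    meet it and repeating bounds the measure of the union by (c / lambda) times
    the integral of |f| over the union (finite_vitali); continuity of nu from
    below passes to the countable family (countable_vitali). *)

(** * Comparison of integrals through simple functions *)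

Section integral_comparison.
Context d (T : measurableType d) (R : realType).
Context (mu : {measure set T -> \bar R}).
Local Open Scope ereal_scope.
Import HBNNSimple.

(** The integral of a nonnegative function is a supremum over the simple
    functions below it, so it is monotone whether or not the functions and the
    sets are measurable. This spares the measurability of the translation as a
    function of y, and that of the level sets of the maximal function. *)
Lemma ge0_le_integral_support (A B : set T) (f g : T -> \bar R) :
  (forall x, B x -> 0 <= g x) -> (forall x, A x -> 0 <= f x) ->
  (forall x, A x -> B x -> f x <= g x) ->
  (forall x, A x -> ~ B x -> f x = 0) ->
  \int[mu]_(x in A) f x <= \int[mu]_(x in B) g x.
Proof.
move=> g0 f0 fg fN; rewrite !ge0_integralE//.
apply: le_ereal_sup => _ [h hf <-]; exists h => // x.
apply: le_trans (hf x) _; rewrite !patchE.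
case: ifPn => [/set_mem Ax|_].
  case: ifPn => [/set_mem Bx|/negP nBx]; first exact: fg.
  by rewrite fN// => Bx; apply: nBx; exact: mem_set.
by case: ifPn => // /set_mem; exact: g0.
Qed.

Lemma abse_integral_le_support (A B : set T) (f g : T -> \bar R) :
  (forall x, B x -> 0 <= g x) ->
  (forall x, A x -> B x -> `|f x| <= g x) ->
  (forall x, A x -> ~ B x -> f x = 0) ->
  `|\int[mu]_(x in A) f x| <= \int[mu]_(x in B) g x.
Proof.
move=> g0 fg fN.
have fp : \int[mu]_(x in A) f^\+ x <= \int[mu]_(x in B) g x.
  apply: ge0_le_integral_support => // x Ax Bx; rewrite funeposE.
    by apply: le_trans (fg _ Ax Bx); rewrite ge_max lee_abs abse_ge0.
  by rewrite fN// maxxx.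
have fn : \int[mu]_(x in A) f^\- x <= \int[mu]_(x in B) g x.
  apply: ge0_le_integral_support => // x Ax Bx; rewrite funenegE.
    by apply: le_trans (fg _ Ax Bx); rewrite ge_max -abseN lee_abs abse_ge0.
  by rewrite fN// oppe0 maxxx.
(* When both parts of f have infinite integral, so does g. *)
rewrite integralE; move: fp fn.
have : 0 <= \int[mu]_(x in A) f^\+ x by exact: integral_ge0.
have : 0 <= \int[mu]_(x in A) f^\- x by exact: integral_ge0.
move: (\int[mu]_(x in A) f^\+ x) (\int[mu]_(x in A) f^\- x)
  (\int[mu]_(x in B) g x).
move=> [p| |] [n| |] [r| |] //=; rewrite ?lee_fin ?leey// => p0 n0 pr nr.
by rewrite ler_norml; lra.
Qed.
End integral_comparison.

(** * Integrals of powers with an integrable singularity *)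

Section singular_integrals.
Context (R : realType).
Local Notation leb := (@lebesgue_measure R).

(** The fundamental theorem of calculus on compact subintervals, followed by
    monotone convergence: F and f may be singular at both endpoints. *)
Lemma integral_derive_le (F f : R -> R) (a b M : R) : 0 <= M ->
  (forall x, a < x < b -> is_derive x 1 F (f x)) ->
  (forall x, a < x < b -> {for x, continuous f}) ->
  (forall x, a < x < b -> 0 <= f x) ->
  (forall u v, a < u -> u < v -> v < b -> F v - F u <= M) ->
  (\int[leb]_(x in `]a, b[) (f x)%:E <= M%:E)%E.
Proof.
move=> M0 dF cf f0 FM.
have [e [e0 ex ee]] : exists e : nat -> R, [/\ forall n, 0 < e n,
    forall r, 0 < r -> exists n, e n < r &
    forall m n, (m <= n)%N -> e n <= e m].
  exists (fun n => n.+1%:R^-1); split=> [n|r r0|m n mn].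
  - by rewrite invr_gt0.
  - by have [n] := ltr_add_invr r0; rewrite add0r; exists n.
  - by rewrite lef_pV2 ?posrE// ler_nat.
pose K (n : nat) : set R := `[a + e n, b - e n]%classic.
have Kab n : K n `<=` `]a, b[.
  move=> x; rewrite /K/= !in_itv/= => /andP[ax xb].
  by have := e0 n; move=> ?; apply/andP; split; lra.
have KU : \bigcup_n K n = `]a, b[%classic.
  apply/seteqP; split => [x [n _]|x]; first exact: Kab.
  rewrite /= in_itv/= => /andP[ax xb].
  have m0 : 0 < Num.min (x - a) (b - x) by rewrite lt_min !subr_gt0 ax.
  have [n] := ex _ m0; rewrite lt_min => /andP[n1 n2].
  by exists n => //; rewrite /K/= in_itv/=; apply/andP; split; lra.
have ndK : nondecreasing_seq K.
  move=> m n mn; rewrite subsetEset => x.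
  rewrite /K/= !in_itv/= => /andP[ax xb].
  by have := ee m n mn; move=> ?; apply/andP; split; lra.
have mf : measurable_fun `]a, b[ f.
  apply: open_continuous_measurable_fun => // x; rewrite inE/= in_itv/=.
  exact: cf.
have /cvg_lim <- // : (\int[leb]_(x in K n) (f x)%:E)%E @[n --> \oo] -->
    (\int[leb]_(x in `]a, b[) (f x)%:E)%E.
  rewrite -KU; apply: ge0_nondecreasing_set_cvg_integral => //.
  - move=> n; exact: measurable_itv.
  - move=> n; apply/measurable_EFinP; apply: measurable_funS mf => //.
  - by move=> n x /Kab/=; rewrite in_itv/= lee_fin; exact: f0.
apply: lime_le.
  apply: ereal_nondecreasing_is_cvgn.
  apply: ge0_nondecreasing_set_nondecreasing_integral => //.
  - move=> n; exact: measurable_itv.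
  - move=> n; apply/measurable_EFinP; apply: measurable_funS mf => //.
  - by move=> n x /Kab/=; rewrite in_itv/= lee_fin; exact: f0.
apply: nearW => n.
have n0 := e0 n.
have [ltab|] := ltP (a + e n) (b - e n); last first.
  rewrite le_eqVlt => /predU1P[E|E].
    by rewrite /K -E set_itv1 integral_set1.
  by rewrite /K set_itv_ge ?integral_set0// bnd_simp -ltNge.
have dFi x : a < x < b -> derivable F x 1 by move=> /dF dFx; exact: ex_derive.
have cF x : a < x < b -> {for x, continuous F}.
  by move=> /dFi /derivable1_diffP /differentiable_continuous.
rewrite (@continuous_FTC2 _ _ F)//.
- by rewrite -EFinB lee_fin; apply: FM => //; lra.
- apply: continuous_in_subspaceT => x /set_mem /Kab/=; rewrite in_itv/=.
  exact: cf.
- split.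
  + by move=> x; rewrite in_itv/= => /andP[? ?]; apply: dFi; lra.
  + by apply: cvg_at_right_filter; apply: cF; lra.
  + by apply: cvg_at_left_filter; apply: cF; lra.
- move=> x; rewrite in_itv/= => /andP[? ?]; rewrite derive1E.
  by have [|_ ->] := dF x; first lra.
Qed.

Lemma continuous_powR_pos (b x : R) :
  0 < x -> {for x, continuous (@powR R ^~ b)}.
Proof.
move=> x0; apply/differentiable_continuous/derivable1_diffP.
by apply: derivable_powR; rewrite in_itv/= x0.
Qed.

(** The slope s is 1 or -1, which treats x - a and a - x together; then
    1 / s = s. *)
Lemma is_derive_powR_affine (s k c x : R) : s ^+ 2 = 1 -> c != 0 ->
  0 < s * x + k ->
  is_derive x 1 (fun x => s * (s * x + k) `^ c / c) ((s * x + k) `^ (c - 1)).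
Proof.
move=> s1 c0 gx0.
have dg : is_derive x 1 (fun x => s * x + k) s.
  have := is_deriveD (is_deriveZ s (is_derive_id x 1)) (is_derive_cst k x 1).
  rewrite /GRing.scale/= mulr1 addr0; exact.
have h := is_derive1_comp (f := @powR R ^~ c) (g := fun x => s * x + k)
  (is_derive1_powR c gx0) dg.
have := is_deriveZ (s / c) h.
have -> : (s / c) *: (c * (s * x + k) `^ (c - 1) * s) = (s * x + k) `^ (c - 1).
  rewrite /GRing.scale/= -[RHS]mul1r -s1.
  by field.
congr is_derive; apply/funext => y/=.
by rewrite /GRing.scale/= mulrAC.
Qed.

Lemma integral_powR_affine_le (s k a m b M : R) : s ^+ 2 = 1 -> -1 < b ->
  (forall x, a < x < m -> 0 < s * x + k <= M) -> 0 <= M ->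
  (\int[leb]_(x in `]a, m[) ((s * x + k) `^ b)%:E <=
    (M `^ (b + 1) / (b + 1))%:E)%E.
Proof.
move=> s1 b1 gM M0; have q0 : 0 < b + 1 by lra.
apply: (@integral_derive_le (fun x => s * (s * x + k) `^ (b + 1) / (b + 1))).
- by rewrite divr_ge0 ?powR_ge0// ltW.
- move=> x /gM/andP[gx0 _].
  rewrite -[X in _ `^ X](addrK 1).
  by apply: is_derive_powR_affine; rewrite ?gt_eqF.
- move=> x /gM/andP[gx0 _].
  apply: (@continuous_comp _ _ _ (fun x => s * x + k) (@powR R ^~ b)).
    apply: cvgD; last exact: cvg_cst.
    by apply: cvgM; [exact: cvg_cst|exact: cvg_id].
  exact: continuous_powR_pos.
- by move=> x _; exact: powR_ge0.
- move=> u v au uv vm; rewrite -mulrBl ler_pM2r ?invr_gt0//.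
  have /andP[u0 uM] : 0 < s * u + k <= M by apply: gM; lra.
  have /andP[v0 vM] : 0 < s * v + k <= M by apply: gM; lra.
  have := powR_ge0 (s * u + k) (b + 1); have := powR_ge0 (s * v + k) (b + 1).
  have : (s * u + k) `^ (b + 1) <= M `^ (b + 1).
    by apply: ge0_ler_powR; rewrite ?nnegrE//; lra.
  have : (s * v + k) `^ (b + 1) <= M `^ (b + 1).
    by apply: ge0_ler_powR; rewrite ?nnegrE//; lra.
  have /eqP := s1; rewrite sqrf_eq1 => /predU1P[->|/eqP->]; lra.
Qed.
End singular_integrals.

(** * Bounds for the Weinstein kernel *)

Section weinstein_kernel_bound.
Context (R : realType).
Local Notation leb := (@lebesgue_measure R).

(** The sign of the exponent does not matter for comparable bases; this is why
    the exponent b = alpha - 1/2 needs no case distinction later on. *)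
Lemma powR_comparable (k b x y : R) : 0 < x -> 0 < y ->
  x <= k * y -> y <= k * x -> y `^ b <= k `^ `|b| * x `^ b.
Proof.
move=> x0 y0 xky ykx.
have k0 : 0 < k by rewrite -(pmulr_lgt0 _ x0); exact: lt_le_trans ykx.
have [b0|b0] := leP 0 b.
  rewrite ger0_norm// -powRM ?(ltW x0) ?(ltW k0)//.
  by apply: ge0_ler_powR; rewrite ?nnegrE ?mulr_ge0// ltW.
rewrite ltr0_norm// -[X in y `^ X](opprK b) -[X in x `^ X](opprK b).
rewrite !(powRN _ (- b)).
rewrite ler_pdivlMr ?powR_gt0// mulrC ler_pdivrMr ?powR_gt0//.
rewrite -powRM ?(ltW y0) ?(ltW k0)//.
by apply: ge0_ler_powR; rewrite ?nnegrE ?mulr_ge0 ?oppr_ge0// ltW.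
Qed.

Lemma measurable_powR_affine (D : set R) (s k b : R) :
  measurable_fun D (fun x => (s * x + k) `^ b).
Proof.
apply: (measurableT_comp (measurable_powR _)).
by apply: measurable_funD => //; apply: measurable_funM.
Qed.

(** Left of the midpoint of ]a, e[ the factor (e - x)^b is comparable to
    (e - a)^b, right of it (x - a)^b is. The right half only matters when m
    exceeds the midpoint, and then e - a <= 2 (m - a). *)
Lemma integral_beta_le (a m e b : R) : -1 < b -> a < m -> m <= e ->
  (\int[leb]_(x in `]a, m[) ((e - x) `^ b * (x - a) `^ b)%:E <=
   (2 `^ `|b| * (1 + 2 `^ (b + 1)) / (b + 1)
      * ((e - a) `^ b * (m - a) `^ (b + 1)))%:E)%E.
Proof.
move=> b1 am me.
have q0 : 0 < b + 1 by lra.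
have ea : a < e by exact: lt_le_trans me.
pose L x := (1 * x + - a) `^ b; pose U x := (-1 * x + e) `^ b.
have EL x : (x - a) `^ b = L x by rewrite /L mul1r.
have EU x : (e - x) `^ b = U x by rewrite /U mulN1r addrC.
have IL : (\int[leb]_(x in `]a, m[) (L x)%:E <=
    ((m - a) `^ (b + 1) / (b + 1))%:E)%E.
  apply: integral_powR_affine_le => //; rewrite ?expr1n//; last by lra.
  by move=> x /andP[ax xm]; lra.
(* t switches off the part of the right half. *)
pose t := (if m <= (a + e) / 2 then 0 else 1) : R.
have t0 : 0 <= t by rewrite /t; case: ifP.
have tIU : (t%:E * \int[leb]_(x in `]a, m[) (U x)%:E <=
    (2 `^ (b + 1) * ((m - a) `^ (b + 1) / (b + 1)))%:E)%E.
  rewrite /t; case: ifPn => [_|]; last rewrite -ltNge => hm.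
    by rewrite mul0e lee_fin mulr_ge0 ?powR_ge0// divr_ge0 ?powR_ge0// ltW.
  rewrite mul1e mulrA -powRM//; last by lra.
  apply: integral_powR_affine_le => //; rewrite ?sqrrN ?expr1n//; last by lra.
  by move=> x /andP[ax xm]; lra.
have c0 : 0 <= 2 `^ `|b| * (e - a) `^ b by rewrite mulr_ge0 ?powR_ge0.
have mL : measurable_fun `]a, m[ (fun x => (L x)%:E).
  by apply/measurable_EFinP; exact: measurable_powR_affine.
have mU : measurable_fun `]a, m[ (fun x => (U x)%:E).
  by apply/measurable_EFinP; exact: measurable_powR_affine.
have mtU : measurable_fun `]a, m[ (fun x => t%:E * (U x)%:E)%E.
  by apply: emeasurable_funM.
apply: (@le_trans _ _ ((2 `^ `|b| * (e - a) `^ b)%:E *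
   (\int[leb]_(x in `]a, m[) (L x)%:E +
    t%:E * \int[leb]_(x in `]a, m[) (U x)%:E))%E); last first.
  apply: (@le_trans _ _ ((2 `^ `|b| * (e - a) `^ b)%:E *
     (((m - a) `^ (b + 1) / (b + 1))%:E +
      (2 `^ (b + 1) * ((m - a) `^ (b + 1) / (b + 1)))%:E))%E).
    by rewrite lee_wpmul2l ?lee_fin// leeD.
  rewrite -EFinD -EFinM lee_fin le_eqVlt; apply/orP; left; apply/eqP.
  by field; rewrite gt_eqF.
rewrite -ge0_integralZl//; last by move=> x _; rewrite lee_fin powR_ge0.
rewrite -ge0_integralD//; last 2 first.
- by move=> x _; rewrite lee_fin powR_ge0.
- by move=> x _; rewrite mule_ge0 ?lee_fin ?powR_ge0.
rewrite -ge0_integralZl//; last 2 first.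
- exact: emeasurable_funD.
- by move=> x _; rewrite adde_ge0 ?mule_ge0 ?lee_fin ?powR_ge0.
apply: ge0_le_integral_support => //.
- by move=> x _; rewrite mule_ge0// ?adde_ge0 ?mule_ge0 ?lee_fin ?powR_ge0.
- by move=> x _; rewrite lee_fin mulr_ge0 ?powR_ge0.
move=> x + _; rewrite /= in_itv/= => /andP[ax xm].
rewrite -[(t%:E * _)%E]EFinM -EFinD -EFinM lee_fin EL EU.
have L0 : 0 <= L x by exact: powR_ge0.
have U0 : 0 <= U x by exact: powR_ge0.
have [xh|xh] := leP x ((a + e) / 2).
  apply: (@le_trans _ _ (2 `^ `|b| * (e - a) `^ b * L x)); last first.
    by rewrite ler_wpM2l// lerDl mulr_ge0.
  rewrite ler_wpM2r// -EU; apply: powR_comparable; lra.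
have -> : t = 1 by rewrite /t ifF//; apply/negbTE; rewrite -ltNge; lra.
apply: (@le_trans _ _ (2 `^ `|b| * (e - a) `^ b * U x)); last first.
  by rewrite ler_wpM2l// mul1r lerDr.
rewrite mulrC ler_wpM2r// -EL; apply: powR_comparable; lra.
Qed.

Lemma Gamma_ge0 (c : R) : 0 <= Gamma c.
Proof.
by apply: Rintegral_ge0 => t _; rewrite mulr_ge0 ?powR_ge0 ?expR_ge0.
Qed.

Lemma weinstein_kernel_ge0 (alpha s t rho : R) :
  0 <= weinstein_kernel alpha s t rho.
Proof.
rewrite /weinstein_kernel; case: ifP => // _.
by rewrite divr_ge0 ?mulr_ge0 ?powR_ge0 ?Gamma_ge0 ?sqrtr_ge0.
Qed.

(** Factor the two differences of squares. As rho lies between |s - t| and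
    s + t, the factor s + t + rho is comparable to s + t and rho + |s - t| is
    comparable to rho; what remains is the beta density
    (s + t - rho)^b (rho - |s - t|)^b. Necessarily b = alpha - 1/2 and
    q = alpha + 1/2. *)
Lemma weinstein_kernel_weight_le (alpha b q : R) :
  -1 < b -> 2 * alpha = b + q -> q = b + 1 ->
  exists2 A : R, 0 <= A & forall s t m rho : R, 0 < s -> 0 < t ->
  m <= s + t -> `|s - t| < rho -> rho < m ->
  weinstein_kernel alpha s t rho * rho `^ (2 * alpha + 1) <=
  A * ((s * t) `^ (- (2 * alpha)) * (s + t) `^ b * m `^ q)
    * ((s + t - rho) `^ b * (rho - `|s - t|) `^ b).
Proof.
move=> b1 alb qb.
pose A0 := Gamma (alpha + 1) /
  (2 `^ (2 * alpha - 1) * Num.sqrt pi * Gamma (alpha + 2^-1)).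
have A0_ge0 : 0 <= A0.
  by rewrite divr_ge0 ?mulr_ge0 ?powR_ge0 ?Gamma_ge0 ?sqrtr_ge0.
exists (A0 * (2 `^ `|b|) ^+ 2).
  by apply: mulr_ge0; rewrite ?exprn_ge0 ?powR_ge0.
move=> s t m rho s0 t0 mst arho rhom.
have a0 : 0 <= `|s - t| by [].
have rho0 : 0 < rho by exact: le_lt_trans arho.
have rhost : rho < s + t by exact: lt_le_trans mst.
rewrite /weinstein_kernel arho rhost/= (_ : alpha - 2^-1 = b); last by lra.
have -> : (s + t) ^+ 2 - rho ^+ 2 = (s + t - rho) * (s + t + rho) by ring.
have -> : rho ^+ 2 - (s - t) ^+ 2 = (rho - `|s - t|) * (rho + `|s - t|).
  by rewrite -(real_normK (num_real (s - t))); ring.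
rewrite (powRM b (x := s + t - rho)); [|lra|lra].
rewrite (powRM b (x := rho - `|s - t|)); [|lra|lra].
rewrite (powRM (2 * alpha) (x := s * t)); last 2 first.
- by rewrite mulr_ge0// ltW.
- exact: ltW.
rewrite (powRD (x := rho) (r := 2 * alpha)); last first.
  by apply/implyP => _; rewrite gt_eqF.
rewrite (powRr1 (ltW rho0)) powRN.
have h1 : (s + t + rho) `^ b <= 2 `^ `|b| * (s + t) `^ b.
  by apply: powR_comparable; lra.
have h2 : (rho + `|s - t|) `^ b * rho <= 2 `^ `|b| * m `^ q.
  apply: (@le_trans _ _ (2 `^ `|b| * rho `^ b * rho)).
    by rewrite ler_wpM2r ?(ltW rho0)//; apply: powR_comparable; lra.
  rewrite -mulrA ler_wpM2l ?powR_ge0//.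
  rewrite -[X in _ * X](powRr1 (ltW rho0)) -powRD; last first.
    by apply/implyP => _; rewrite gt_eqF.
  rewrite -qb.
  have q0 : 0 <= q by lra.
  by apply: ge0_ler_powR; rewrite ?nnegrE //; lra.
have P0 : 0 <= (s + t - rho) `^ b * (rho - `|s - t|) `^ b.
  by rewrite mulr_ge0 ?powR_ge0.
have rhon0 : rho `^ (2 * alpha) != 0 by rewrite gt_eqF ?powR_gt0.
have st0 : 0 <= ((s * t) `^ (2 * alpha))^-1 by rewrite invr_ge0 powR_ge0.
rewrite [leLHS](_ : _ = A0 * ((s * t) `^ (2 * alpha))^-1
  * ((s + t + rho) `^ b * ((rho + `|s - t|) `^ b * rho))
  * ((s + t - rho) `^ b * (rho - `|s - t|) `^ b)); last first.
  rewrite /A0 !invfM -[RHS]mulr1 -[X in _ = _ * X](mulVf rhon0); ring.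
rewrite ler_wpM2r//.
rewrite [leRHS](_ : _ = A0 * ((s * t) `^ (2 * alpha))^-1
  * ((2 `^ `|b| * (s + t) `^ b) * (2 `^ `|b| * m `^ q))); last by ring.
apply: ler_wpM2l; first by rewrite mulr_ge0.
by apply: ler_pM; rewrite // ?mulr_ge0 ?powR_ge0// ltW.
Qed.

(** The two factors are, up to a factor 2, the maximum and the minimum of s and
    t. *)
Lemma sum_times_gap_bounds (s t : R) : 0 < s -> 0 < t ->
  s * t <= (s + t) * (s + t - `|s - t|) <= 4 * (s * t).
Proof.
move=> s0 t0; have [ts|ts] := leP t s.
  by rewrite ger0_norm ?subr_ge0//; apply/andP; split; nra.
by rewrite ltr0_norm ?subr_lt0//; apply/andP; split; nra.
Qed.

(** If eps is at least s / 4, the right-hand side is comparable to s t and m is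
    at most s + t. Otherwise |s - t| <= 2 eps < s / 2, so s and t are
    comparable and the left-hand side is at most 4 eps^2. *)
Lemma truncated_width_le (s t eps m : R) : 0 < s -> 0 < t -> 0 < eps ->
  `|s - t| <= m -> m <= s + t -> m <= 2 * eps ->
  m * (m - `|s - t|) <= 100 * (s * t * (eps / (s + eps)) ^+ 2).
Proof.
move=> s0 t0 e0 am mst me.
have a0 : 0 <= `|s - t| by [].
have m0 : 0 <= m by exact: le_trans am.
have ma0 : 0 <= m - `|s - t| by rewrite subr_ge0.
have ses : 0 < s + eps by lra.
have st0 : 0 < s * t by exact: mulr_gt0.
rewrite expr_div_n !mulrA ler_pdivlMr ?exprn_gt0//.
have mm : m * (m - `|s - t|) <= 4 * (s * t).
  apply: (@le_trans _ _ ((s + t) * (s + t - `|s - t|))).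
    by apply: ler_pM => //; lra.
  by have /andP[] := sum_times_gap_bounds s0 t0.
have [se|se] := leP s (4 * eps).
  have se2 : (s + eps) ^+ 2 <= 25 * eps ^+ 2 by nra.
  have := ler_pM (mulr_ge0 m0 ma0) (exprn_ge0 2 (ltW ses)) mm se2.
  lra.
have tst : s / 2 < t by have := ler_norm (s - t); lra.
have mm2 : m * (m - `|s - t|) <= (2 * eps) * (2 * eps).
  by apply: ler_pM => //; lra.
have sest : (s + eps) ^+ 2 <= 25 * (s * t) by nra.
have := ler_pM (mulr_ge0 m0 ma0) (exprn_ge0 2 (ltW ses)) mm2 sest.
lra.
Qed.

(** The cut-off chi stands for a section of the characteristic function of a
    half-ball of radius eps. Over ]a, m[, with a = |s - t| and
    m = min (s + t, 2 eps), the weight integrates to at most a constant times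
    (s t)^(-2 alpha) ((s + t) (s + t - a))^b (m (m - a))^q, and the exponents
    of s t add up to 0 once sum_times_gap_bounds and truncated_width_le are
    applied. *)
Lemma integral_weinstein_kernel_le (alpha : R) : - 2^-1 < alpha ->
  exists2 C : R, 0 <= C &
  forall s t eps : R, 0 < s -> 0 < t -> 0 < eps ->
  forall chi : R -> R, (forall rho, 0 <= chi rho <= 1) ->
  (forall rho, eps < rho -> chi rho = 0) ->
  (`|\int[leb]_(rho in `]0%R, +oo[)
      (chi rho * weinstein_kernel alpha s t rho * rho `^ (2 * alpha + 1))%:E| <=
   (C * (eps / (s + eps)) `^ (2 * alpha + 1))%:E)%E.
Proof.
move=> al1.
have [b [q [b1 q0 alb alq qb]]] : exists b q : R, [/\ -1 < b, 0 < q,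
    2 * alpha = b + q, 2 * alpha + 1 = 2%:R * q & q = b + 1].
  by exists (alpha - 2^-1), (alpha + 2^-1); split; lra.
have [A A_ge0 kernel_le] := weinstein_kernel_weight_le b1 alb qb.
have [B B_ge0 beta_le] : exists2 B : R, 0 <= B & forall a m e : R,
    a < m -> m <= e ->
    (\int[leb]_(x in `]a, m[) ((e - x) `^ b * (x - a) `^ b)%:E <=
     (B * ((e - a) `^ b * (m - a) `^ q))%:E)%E.
  exists (2 `^ `|b| * (1 + 2 `^ (b + 1)) / (b + 1)) => [|a m e am me].
    rewrite -qb; apply: divr_ge0; last exact: ltW.
    by rewrite mulr_ge0 ?addr_ge0 ?powR_ge0.
  by rewrite qb; exact: integral_beta_le.
exists (A * B * 4 `^ `|b| * 100 `^ q) => [|s t eps s0 t0 e0 chi chi01 chi0].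
  by rewrite !mulr_ge0 ?powR_ge0.
(* The bound 2 * eps, rather than eps, makes room for an open interval. *)
pose a := `|s - t|; pose m := Num.min (s + t) (2 * eps).
have mst : m <= s + t by rewrite /m ge_min lexx.
have me : m <= 2 * eps by rewrite /m ge_min lexx orbT.
pose K := A * ((s * t) `^ (- (2 * alpha)) * (s + t) `^ b * m `^ q).
have K0 : 0 <= K by rewrite /K !mulr_ge0 ?exprn_ge0 ?powR_ge0.
pose beta rho := (s + t - rho) `^ b * (rho - a) `^ b.
have beta0 rho : 0 <= beta rho by rewrite mulr_ge0 ?powR_ge0.
apply: (@le_trans _ _ (\int[leb]_(rho in `]a, m[) (K * beta rho)%:E)%E).
  apply: abse_integral_le_support => [x _|x|x].
  - by rewrite lee_fin mulr_ge0.
  - rewrite /= !in_itv/= andbT => x0 /andP[ax xm].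
    rewrite lee_fin -mulrA.
    have hw := kernel_le _ _ _ _ s0 t0 mst ax xm.
    have w0 : 0 <= weinstein_kernel alpha s t x * x `^ (2 * alpha + 1).
      by rewrite mulr_ge0 ?powR_ge0 ?weinstein_kernel_ge0.
    have /andP[c0 c1] := chi01 x.
    rewrite ger0_norm; last exact: mulr_ge0.
    apply: le_trans hw.
    by rewrite ler_piMl.
  - rewrite /= !in_itv/= andbT => x0 axm; congr EFin.
    have [xe|xe] := ltP eps x; first by rewrite chi0// !mul0r.
    rewrite /weinstein_kernel; case: ifPn => [/andP[ax xst]|]; last first.
      by rewrite mulr0 mul0r.
    exfalso; apply: axm; rewrite ax/= lt_min xst/=; lra.
have [am|am] := ltP a m; last first.
  rewrite set_itv_ge ?bnd_simp -?leNgt// integral_set0 lee_fin.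
  by rewrite !mulr_ge0 ?exprn_ge0 ?powR_ge0.
under eq_integral do rewrite EFinM.
rewrite ge0_integralZl//; last 2 first.
- apply/measurable_EFinP; apply: measurable_funM.
    rewrite (_ : (fun x => _) = (fun x => (-1 * x + (s + t)) `^ b)).
      exact: measurable_powR_affine.
    by apply/funext => x; rewrite mulN1r addrC.
  rewrite (_ : (fun x => _) = (fun x => (1 * x + (- a)) `^ b)).
    exact: measurable_powR_affine.
  by apply/funext => x; rewrite mul1r.
- by move=> x _; rewrite lee_fin.
apply: (@le_trans _ _ (K%:E * (B * ((s + t - a) `^ b * (m - a) `^ q))%:E)%E).
  by rewrite lee_wpmul2l ?lee_fin//; exact: beta_le.
rewrite -EFinM lee_fin.
have a0 : 0 <= a by rewrite /a.
have st0 : 0 < s * t by rewrite mulr_gt0.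
have /andP[sta1 sta2] : s * t <= (s + t) * (s + t - a) <= 4 * (s * t).
  exact: sum_times_gap_bounds.
have sta0 : 0 < s + t - a by lra.
have h1 : (s + t) `^ b * (s + t - a) `^ b <= 4 `^ `|b| * (s * t) `^ b.
  rewrite -powRM ?(ltW sta0)//; last by lra.
  apply: powR_comparable => //; first exact: lt_le_trans sta1.
  by lra.
have h2 : m `^ q * (m - a) `^ q <=
    100 `^ q * ((s * t) `^ q * (eps / (s + eps)) `^ (2 * alpha + 1)).
  have ese : 0 <= eps / (s + eps) by rewrite divr_ge0//; lra.
  rewrite alq powRrM powR_mulrn//.
  have m0 : 0 <= m by lra.
  have ma0 : 0 <= m - a by lra.
  have ses : 0 < s + eps by lra.
  have [st0' ese2] : 0 <= s * t /\ 0 <= (eps / (s + eps)) ^+ 2.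
    by rewrite ltW// exprn_ge0.
  have ste2 : 0 <= s * t * (eps / (s + eps)) ^+ 2 by exact: mulr_ge0.
  rewrite -(powRM _ m0 ma0) -(powRM _ st0' ese2) -(powRM _ _ ste2)//.
  apply: ge0_ler_powR; rewrite ?nnegrE.
  - exact: ltW.
  - exact: mulr_ge0.
  - exact: mulr_ge0.
  exact: truncated_width_le (ltW am) mst me.
have hst : (s * t) `^ (- (2 * alpha)) * (s * t) `^ b * (s * t) `^ q = 1.
  rewrite -!powRD; [|by apply/implyP => _; rewrite gt_eqF..].
  by rewrite alb (_ : _ + q = 0) ?powRr0//; ring.
have := ler_pM _ _ h1 h2.
rewrite !mulr_ge0 ?powR_ge0// => /(_ isT isT) h.
apply: (@le_trans _ _ (A * B * (s * t) `^ (- (2 * alpha)) *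
  (4 `^ `|b| * (s * t) `^ b *
    (100 `^ q * ((s * t) `^ q * (eps / (s + eps)) `^ (2 * alpha + 1)))))).
  rewrite /K [leLHS](_ : _ = A * B * (s * t) `^ (- (2 * alpha)) *
     ((s + t) `^ b * (s + t - a) `^ b * (m `^ q * (m - a) `^ q))); last by ring.
  by apply: ler_wpM2l => //; rewrite !mulr_ge0 ?exprn_ge0 ?powR_ge0.
rewrite le_eqVlt; apply/orP; left; apply/eqP.
rewrite -[RHS]mulr1 -[X in _ = _ * X]hst; ring.
Qed.

End weinstein_kernel_bound.

(** * The translation of a half-ball lives on a cube *)

Section cubes.
Context (R : realType) (d : nat).
Implicit Types x y z : Rd R d.

Definition sup_ball z (r : R) : set (Rd R d) :=
  [set y | (forall i, `|tnth z.1 i - tnth y.1 i| <= r) /\ `|z.2 - y.2| <= r].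

Lemma edist_le_sup_ball x y (r : R) : Defs.edist x y <= r -> sup_ball x r y.
Proof.
rewrite /Defs.edist; set S := (\sum_(i < _) _ + _) => Sr.
have Ssum i : (tnth x.1 i - tnth y.1 i) ^+ 2 <= S.
  rewrite /S (bigD1 i)//= -addrA lerDl addr_ge0 ?sqr_ge0// sumr_ge0// => j _.
  exact: sqr_ge0.
have Slast : (x.2 - y.2) ^+ 2 <= S.
  by rewrite /S lerDr sumr_ge0// => j _; exact: sqr_ge0.
by split => [i|]; rewrite -sqrtr_sqr (le_trans _ Sr)// ler_wsqrtr.
Qed.

Lemma sup_ball_sym x y (r : R) : sup_ball x r y -> sup_ball y r x.
Proof. by move=> [h1 h2]; split => [i|]; rewrite distrC. Qed.

Lemma sup_ball_trans x y z (r s : R) :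
  sup_ball x r y -> sup_ball y s z -> sup_ball x (r + s) z.
Proof.
move=> [h1 h2] [k1 k2]; split => [i|].
  rewrite -(subrKA (tnth y.1 i)).
  exact: le_trans (ler_normD _ _) (lerD (h1 i) (k1 i)).
rewrite -(subrKA y.2).
exact: le_trans (ler_normD _ _) (lerD h2 k2).
Qed.

Lemma sup_ball_le z (r s : R) : r <= s -> sup_ball z r `<=` sup_ball z s.
Proof.
by move=> rs y [h1 h2]; split => [i|]; exact: le_trans rs.
Qed.

End cubes.

Section translation.
Context (R : realType) (d : nat) (alpha : R).
Implicit Types x y z : Rd R d.

Local Notation shift_point z y rho :=
  ([tuple tnth z.1 i + tnth (flip_horizontal y).1 i | i < d.-1], rho).

Lemma ball_plus_origin z y eps (rho : R) :
  ball_plus origin eps (shift_point z y rho) ->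
  rho <= eps /\ forall i, `|tnth z.1 i - tnth y.1 i| <= eps.
Proof.
move=> [/= /edist_le_sup_ball[/= h1 h2] _]; split.
  by apply: le_trans h2; rewrite sub0r normrN ler_norm.
move=> i; have := h1 i.
by rewrite !tnth_mktuple sub0r normrN.
Qed.

(** A contributing rho has |z_d - y_d| < rho by the support of the kernel, and
    rho <= eps by that of the half-ball. *)
Lemma weinstein_translation_out z y (eps : R) :
  ~ sup_ball z eps y ->
  weinstein_translation alpha z \1_(ball_plus origin eps)
    (flip_horizontal y) = 0.
Proof.
move=> zy; rewrite /weinstein_translation /Rintegral integral0_eq// => rho _.
congr EFin; rewrite indicE.
have [/set_mem/ball_plus_origin[re zye]|_] :=
  boolP (shift_point z y rho \in ball_plus origin eps); last by rewrite !mul0r.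
rewrite /weinstein_kernel; case: ifPn => [/andP[zyr _]|_]; last first.
  by rewrite mulr0 mul0r.
by exfalso; apply: zy; split => //; apply: ltW; exact: lt_le_trans re.
Qed.

Lemma weinstein_translation_le : - 2^-1 < alpha ->
  exists2 C : R, 0 <= C & forall z y eps, halfspace z -> halfspace y ->
  0 < eps ->
  `|weinstein_translation alpha z \1_(ball_plus origin eps) (flip_horizontal y)|
  <= C * (eps / (z.2 + eps)) `^ (2 * alpha + 1).
Proof.
move=> /integral_weinstein_kernel_le[C C0 kernel_le]; exists C => //.
move=> z y eps z0 y0 e0; rewrite /weinstein_translation /Rintegral.
have := kernel_le _ _ _ z0 y0 e0
  (fun rho => \1_(ball_plus origin eps) (shift_point z y rho)).
set I := (X in (`|X| <= _)%E) => h.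
have : (`|I| <= (C * (eps / (z.2 + eps)) `^ (2 * alpha + 1))%:E)%E.
  apply: h => [rho|rho er]; first by rewrite indicE; case: (_ \in _) => /=; lra.
  rewrite indicE; case: (boolP (_ \in _)) => // /set_mem/ball_plus_origin[].
  by move=> re; lra.
change (fine _) with (fine I).
by case: (I) => [r| |] //=; rewrite lee_fin.
Qed.

End translation.

(** * The measure of cubes and half-balls *)

Section measures.
Context (R : realType).

Definition box n (c : n.-tuple R) (r : R) : set (n.-tuple R) :=
  [set t | forall i, `|tnth c i - tnth t i| <= r].

Lemma itv_dist (c r : R) : [set x | `|c - x| <= r] = `[c - r, c + r]%classic.
Proof.
by apply/seteqP; split => x /=; rewrite in_itv/= ler_distlC.
Qed.

Lemma measurable_box n (c : n.-tuple R) (r : R) : measurable (box c r).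
Proof.
rewrite (_ : box c r = \bigcap_(i in [set: 'I_n])
    ((fun t => tnth t i) @^-1` [set x | `|tnth c i - x| <= r])).
  apply: fin_bigcap_measurable => [|i _]; first exact: finite_finset.
  rewrite -[X in measurable X]setTI itv_dist.
  by apply: measurable_tnth => //; exact: measurable_itv.
by apply/seteqP; split => [t tr i _|t tr i]; [exact: tr|exact: (tr i)].
Qed.

Lemma lebesgue_tuple_box n (c : n.-tuple R) (r : R) : 0 <= r ->
  lebesgue_tuple (box c r) = ((2 * r) ^+ n)%:E.
Proof.
move=> r0; elim: n c => [|n IHn] c.
  by rewrite /= diracE mem_set// => -[].
rewrite /= /pushforward.
rewrite (_ : _ @^-1` _ =
  [set x | `|thead c - x| <= r] `*` box [tuple of behead c] r); last first.
  apply/seteqP; split => [[x t]|[x t]] /=.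
    move=> h; split; first exact: (h ord0).
    move=> i; have := h (lift ord0 i).
    by rewrite !(tnth_nth 0)/= /bump/= add1n nth_behead.
  move=> [h1 h2] i; case: (unliftP ord0 i) => [j ->|->]; last exact: h1.
  by have := h2 j; rewrite !(tnth_nth 0)/= /bump/= add1n nth_behead.
rewrite itv_dist product_measure1E//; last exact: measurable_box.
rewrite [X in (_ * X)%E]IHn.
rewrite [X in (X * _)%E]lebesgue_measure_itv/= lte_fin.
case: ltP => h; first by rewrite -EFinB -EFinM exprS; congr (_ * _)%:E; ring.
have -> : r = 0 by lra.
by rewrite mul0e mulr0 expr0n.
Qed.

Lemma measurable_sup_ball d (z : Rd R d) (r : R) : measurable (sup_ball z r).
Proof.
rewrite (_ : sup_ball z r = box z.1 r `*` [set x | `|z.2 - x| <= r])//.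
apply: measurableX; first exact: measurable_box.
by rewrite itv_dist; exact: measurable_itv.
Qed.

(** The exponent is written (d.-1).+1 since a point of Rd R d has d.-1
    coordinates besides the last one. *)
Lemma lebesgue_sup_ball d (z : Rd R d) (r : R) : 0 <= r ->
  lebesgue_Rd (sup_ball z r) = ((2 * r) ^+ (d.-1).+1)%:E.
Proof.
move=> r0; rewrite /lebesgue_Rd.
rewrite (_ : sup_ball z r = box z.1 r `*` [set x | `|z.2 - x| <= r])//.
rewrite product_measure1E//; [|exact: measurable_box|].
  rewrite [X in (X * _)%E]lebesgue_tuple_box// itv_dist.
  rewrite [X in (_ * X)%E]lebesgue_measure_itv/= lte_fin.
  case: ltP => h; first by rewrite -EFinB -EFinM exprSr; congr (_ * _)%:E; ring.
  have -> : r = 0 by lra.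
  by rewrite mule0 mulr0 expr0n.
by rewrite itv_dist; exact: measurable_itv.
Qed.

Lemma measurable_halfspace d : measurable (@halfspace R d).
Proof.
rewrite (_ : halfspace = setT `&` snd @^-1` `]0, +oo[); last first.
  by rewrite setTI; apply/seteqP; split=> x /=; rewrite in_itv/= andbT.
exact: measurable_snd.
Qed.

End measures.

Section nu_estimates.
Context (R : realType) (d : nat) (alpha : R).
Implicit Types (A B : set (Rd R d)) (z : Rd R d).

Definition nu_cst : R :=
  (2 * pi) `^ ((d%:R - 1) / 2) * 2 `^ alpha * Gamma (alpha + 1).

Lemma nu_cst_ge0 : 0 <= nu_cst.
Proof. by rewrite !mulr_ge0 ?powR_ge0 ?Gamma_ge0. Qed.

Lemma nu_density_ge0 (x : Rd R d) : 0 <= nu_density alpha x.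
Proof. by rewrite divr_ge0 ?powR_ge0// nu_cst_ge0. Qed.

Lemma le_nu A B : A `&` halfspace `<=` B -> (nu alpha A <= nu alpha B)%E.
Proof.
move=> AB; apply: ge0_le_integral_support.
- by move=> x _; rewrite lee_fin nu_density_ge0.
- by move=> x _; rewrite lee_fin nu_density_ge0.
- by move=> x _ _; rewrite lexx.
- by move=> x Ax nBx; exfalso; apply: nBx; split; [exact: AB|case: Ax].
Qed.

Lemma nu_eq0 A : nu_cst = 0 -> nu alpha A = 0%E.
Proof.
move=> K0; apply: integral0_eq => x _.
by rewrite /nu_density -/nu_cst K0 invr0 mulr0.
Qed.

Lemma nu_sup_ball_le z (r : R) : - 2^-1 < alpha -> 0 <= r ->
  (nu alpha (sup_ball z r) <=
    ((2 * r) ^+ (d.-1).+1 * ((z.2 + r) `^ (2 * alpha + 1) / nu_cst))%:E)%E.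
Proof.
move=> alpha_gt r0; have p0 : 0 <= 2 * alpha + 1 by lra.
rewrite mulrC EFinM -(lebesgue_sup_ball z r0) -integral_cst; last first.
  exact: measurable_sup_ball.
apply: ge0_le_integral_support.
- by move=> x _; rewrite lee_fin divr_ge0 ?powR_ge0 ?nu_cst_ge0.
- by move=> x _; rewrite lee_fin nu_density_ge0.
- move=> x [[_ xz]]; rewrite /halfspace/= => x0 _; rewrite lee_fin.
  rewrite ler_wpM2r ?invr_ge0 ?nu_cst_ge0//.
  have xzr : x.2 <= z.2 + r by move: xz; rewrite ler_distlC; lra.
  by apply: ge0_ler_powR; rewrite ?nnegrE//; lra.
- by move=> x [].
Qed.

Lemma nu_sup_ball_ge z (r : R) : - 2^-1 < alpha -> 0 <= r -> r < z.2 ->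
  (((2 * r) ^+ (d.-1).+1 * ((z.2 - r) `^ (2 * alpha + 1) / nu_cst))%:E <=
    nu alpha (sup_ball z r))%E.
Proof.
move=> alpha_gt r0 rz; have p0 : 0 <= 2 * alpha + 1 by lra.
rewrite mulrC EFinM -(lebesgue_sup_ball z r0) -integral_cst; last first.
  exact: measurable_sup_ball.
have xzr x : sup_ball z r x -> z.2 - r <= x.2.
  by move=> [_]; rewrite ler_distlC; lra.
apply: ge0_le_integral_support.
- by move=> x _; rewrite lee_fin nu_density_ge0.
- by move=> x _; rewrite lee_fin divr_ge0 ?powR_ge0 ?nu_cst_ge0.
- move=> x /xzr zx _; rewrite lee_fin.
  rewrite ler_wpM2r ?invr_ge0 ?nu_cst_ge0//.
  by apply: ge0_ler_powR; rewrite ?nnegrE//; lra.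
- move=> x zx nx; exfalso; apply: nx; split => //; rewrite /halfspace/=.
  by have := xzr _ zx; lra.
Qed.

(** The half-ball of radius eps contains the cube of half-side k eps centred at
    height 2 k eps, where k = 1 / (3 d): its points have their last coordinate
    between k eps and 3 k eps, hence squared norm at most
    (d - 1 + 9) (k eps)^2 <= 9 d^2 (k eps)^2. *)
Lemma nu_ball_origin_ge : - 2^-1 < alpha -> (1 <= d)%N ->
  exists2 c : R, 0 < c & forall eps : R, 0 < eps ->
  ((c * (eps ^+ (d.-1).+1 * eps `^ (2 * alpha + 1)) / nu_cst)%:E <=
   nu alpha (@ball_plus R d origin eps))%E.
Proof.
move=> alpha_gt d1; pose k : R := (3 * d%:R)^-1.
have d0 : 0 < d%:R :> R by rewrite ltr0n.
have k0 : 0 < k by rewrite invr_gt0 mulr_gt0.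
exists ((2 * k) ^+ (d.-1).+1 * k `^ (2 * alpha + 1)) => [|eps e0].
  by rewrite mulr_gt0 ?exprn_gt0 ?powR_gt0 ?mulr_gt0.
have ke0 : 0 < k * eps by rewrite mulr_gt0.
pose z : Rd R d := ([tuple 0 | i < d.-1], 2 * (k * eps)).
apply: (@le_trans _ _ (nu alpha (sup_ball z (k * eps)))); last first.
  apply: le_nu => x [[h1 h2] x0]; split => //; rewrite /=/Defs.edist.
  rewrite -[leRHS](ger0_norm (ltW e0)) -sqrtr_sqr ler_wsqrtr//.
  have S1 : \sum_(i < d.-1) (tnth (@origin R d).1 i - tnth x.1 i) ^+ 2 <=
      \sum_(i < d.-1) (k * eps) ^+ 2.
    apply: ler_sum => i _; have := h1 i; rewrite /= !tnth_mktuple => h.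
    by rewrite -real_normK ?num_real// lerXn2r ?nnegrE ?(ltW ke0).
  have S2 : ((@origin R d).2 - x.2) ^+ 2 <= (3 * (k * eps)) ^+ 2.
    rewrite /= sub0r sqrrN lerXn2r ?nnegrE ?(ltW x0)//; first by lra.
    by move: h2; rewrite /= ler_distlC; lra.
  apply: le_trans (lerD S1 S2) _.
  rewrite sumr_const card_ord.
  have -> : (k * eps) ^+ 2 *+ d.-1 + (3 * (k * eps)) ^+ 2 =
      (d.-1%:R + 9) * (k * eps) ^+ 2 by rewrite -mulr_natl; ring.
  have keps : 9 * d%:R ^+ 2 * (k * eps) ^+ 2 = eps ^+ 2.
    by rewrite /k; field; rewrite gt_eqF.
  rewrite -keps ler_wpM2r ?sqr_ge0//.
  have : d%:R = d.-1%:R + 1 :> R by rewrite -[in LHS](prednK d1) mulrSr.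
  have : 0 <= d.-1%:R :> R by [].
  by move: (d.-1%:R : R) => u u0 ->; nra.
apply: le_trans (nu_sup_ball_ge alpha_gt _ _); [|exact: ltW|rewrite /=; lra].
rewrite lee_fin /= (_ : 2 * (k * eps) - k * eps = k * eps); last by ring.
rewrite powRM ?(ltW k0) ?(ltW e0)// !exprMn.
by rewrite le_eqVlt; apply/orP; left; apply/eqP; ring.
Qed.

Definition mass (f : Rd R d -> R) (A : set (Rd R d)) : \bar R :=
  \int[@nu R d alpha]_(y in A `&` halfspace) `|f y|%:E.

Lemma mass_ge0 f A : (0 <= mass f A)%E.
Proof. by apply: integral_ge0 => y _; rewrite lee_fin. Qed.

Lemma mass_le f A B : A `<=` B -> (mass f A <= mass f B)%E.
Proof.
move=> AB; apply: ge0_le_integral_support => [y _|y _|y _ _|y [Ay y0] nBy].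
- by rewrite lee_fin.
- by rewrite lee_fin.
- by rewrite lexx.
- by exfalso; apply: nBy; split => //; exact: AB.
Qed.

Lemma massU f A B : measurable_fun halfspace f ->
  measurable A -> measurable B -> [disjoint A & B] ->
  mass f (A `|` B) = (mass f A + mass f B)%E.
Proof.
move=> mf mA mB AB; have mH := @measurable_halfspace R d.
rewrite /mass setIUl ge0_integral_setU//.
- exact: measurableI.
- exact: measurableI.
- apply/measurable_EFinP; apply: measurableT_comp => //.
  by apply: measurable_funS mf => // y [[]|[]].
- apply/eqP/seteqP; split => // y [[Ay _] [By _]].
  by move/eqP : AB => /seteqP[/(_ y) + _]; apply.
Qed.

End nu_estimates.

(** * Vitali covering *)

Lemma seq_argmax (disp : Order.disp_t) (O : orderType disp) (I : eqType)
    (h : I -> O) (s : seq I) : s != [::] ->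
  exists2 i, i \in s & forall j, j \in s -> (h j <= h i)%O.
Proof.
elim: s => // i s IHs _; have [->|/IHs[k ks kmax]] := eqVneq s [::].
  by exists i => [|j]; rewrite ?mem_head// inE => /eqP->.
have [ik|ki] := leP (h i) (h k).
  exists k => [|j]; first by rewrite inE ks orbT.
  by rewrite inE => /predU1P[->//|/kmax].
exists i => [|j]; first exact: mem_head.
rewrite inE => /predU1P[->//|/kmax]/le_trans; apply; exact: ltW.
Qed.

Section vitali.
Local Open Scope ereal_scope.
Context {disp : measure_display} {T : measurableType disp} {R : realType}.
Context (mu : {measure set T -> \bar R}) (eta : set T -> \bar R).

(** Induction on the number of sets, without selecting a disjoint subfamily: a
    set Q i of largest radius covers through Q' i all the sets that meet it, and
    the union U of the others is disjoint from Q i, so the bounds for Q i and U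
    add up by superadditivity of eta. *)
Lemma finite_vitali (I : choiceType) (Q Q' : I -> set T) (rad : I -> R)
    (c : R) :
  (0 <= c)%R ->
  (forall A B, A `<=` B -> eta A <= eta B) ->
  (forall A, 0 <= eta A) ->
  (forall A B, measurable A -> measurable B -> [disjoint A & B] ->
    eta A + eta B <= eta (A `|` B)) ->
  (forall i, measurable (Q i)) -> (forall i, measurable (Q' i)) ->
  (forall i j, (rad j <= rad i)%R -> Q i `&` Q j !=set0 -> Q j `<=` Q' i) ->
  forall s : seq I, (forall i, i \in s -> mu (Q' i) <= c%:E * eta (Q i)) ->
  mu (\bigcup_(i in [set` s]) Q i) <= c%:E * eta (\bigcup_(i in [set` s]) Q i).
Proof.
move=> c0 eta_le eta_ge0 etaU mQ mQ' QQ' s.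
have mU (s' : seq I) : measurable (\bigcup_(i in [set` s']) Q i).
  by apply: fin_bigcup_measurable => // i _; exact: mQ.
have [n] := ubnP (size s).
elim: n s => // n IHn s sn muQ'.
have [->|s0] := eqVneq s [::].
  by rewrite set_nil bigcup_set0 measure0 mule_ge0 ?lee_fin.
have [i im imax] := seq_argmax rad s0.
(* j != i removes i itself when Q i is empty, so that the list shrinks. *)
pose s' := [seq j <- s | (j != i) && `[< Q i `&` Q j = set0 >]].
pose U := \bigcup_(j in [set` s']) Q j.
have sub_s' j : j \in s' -> j \in s by rewrite mem_filter => /andP[].
have iU : [disjoint Q i & U].
  apply/eqP/seteqP; split => // x [Qix [j]].
  rewrite /= mem_filter => /andP[/andP[_ /asboolP ij] _] Qjx.
  by rewrite -[False]/(set0 x) -ij.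
have sub : \bigcup_(j in [set` s]) Q j `<=` Q' i `|` U.
  move=> x [j /= js Qjx].
  have [ij|/eqP/set0P ij] := pselect (Q i `&` Q j = set0); last first.
    by left; apply: (QQ' i j) => //; exact: imax.
  have [ji|ji] := eqVneq j i.
    by left; apply: (QQ' i j) => //; [exact: imax|exists x; rewrite -ji].
  right; exists j => //=; rewrite mem_filter ji js andbT.
  exact/asboolP.
have sup : Q i `|` U `<=` \bigcup_(j in [set` s]) Q j.
  by move=> x [Qix|[j /sub_s' js Qjx]]; [exists i|exists j].
apply: (@le_trans _ _ (mu (Q' i) + mu U)).
  apply: (@le_trans _ _ (mu (Q' i `|` U))); last first.
    by apply: measureU2; [exact: mQ'|exact: mU].
  apply: le_measure; rewrite ?inE; [exact: mU| |exact: sub].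
  by apply: measurableU; [exact: mQ'|exact: mU].
apply: (@le_trans _ _ (c%:E * eta (Q i) + c%:E * eta U)).
  apply: leeD; first exact: muQ'.
  apply: IHn => [|j /sub_s']; last exact: muQ'.
  rewrite ltnS in sn; apply: leq_trans sn; rewrite size_filter.
  rewrite -(count_predC (fun j => (j != i) && `[< Q i `&` Q j = set0 >]) s).
  rewrite -addn1 leq_add2l -has_count; apply/hasP; exists i => //.
  by rewrite /= eqxx.
rewrite -ge0_muleDr//; apply: lee_wpmul2l; first by rewrite lee_fin.
by apply: le_trans (eta_le _ _ sup); apply: etaU => //; exact: mU.
Qed.

(** Exhaust the family by the finitely many indices with code below n. *)
Lemma countable_vitali (I : countType) (Q Q' : I -> set T) (rad : I -> R)
    (c : R) (G : set I) :
  (0 <= c)%R ->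
  (forall A B, A `<=` B -> eta A <= eta B) ->
  (forall A, 0 <= eta A) ->
  (forall A B, measurable A -> measurable B -> [disjoint A & B] ->
    eta A + eta B <= eta (A `|` B)) ->
  (forall i, measurable (Q i)) -> (forall i, measurable (Q' i)) ->
  (forall i j, (rad j <= rad i)%R -> Q i `&` Q j !=set0 -> Q j `<=` Q' i) ->
  (forall i, G i -> mu (Q' i) <= c%:E * eta (Q i)) ->
  mu (\bigcup_(i in G) Q i) <= c%:E * eta setT.
Proof.
move=> c0 eta_le eta_ge0 etaU mQ mQ' QQ' GQ.
pose s n := [seq i <- pmap unpickle (iota 0 n) | `[< G i >]].
pose D n := \bigcup_(i in [set` s n]) Q i.
have sP n i : i \in s n <-> G i /\ exists2 k, (k < n)%N & unpickle k = Some i.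
  rewrite mem_filter mem_pmap; split.
    move=> /andP[/asboolP Gi /mapP[k]]; rewrite mem_iota => kn ki.
    by split => //; exists k.
  move=> [Gi [k kn ki]]; apply/andP; split; first exact/asboolP.
  by apply/mapP; exists k => //; rewrite mem_iota.
have mD n : measurable (D n).
  by apply: fin_bigcup_measurable => // i _; exact: mQ.
have DU : \bigcup_(i in G) Q i = \bigcup_n D n.
  apply/seteqP; split => [x [i Gi Qix]|x [n _ [i /sP[Gi _] Qix]]]; last first.
    by exists i.
  exists (pickle i).+1 => //; exists i => //; apply/sP; split => //.
  by exists (pickle i) => //; exact: pickleK.
have ndD : nondecreasing_seq D.
  move=> m n mn; rewrite subsetEset => x [i /sP[Gi [k km ki]] Qix].
  by exists i => //; apply/sP; split => //; exists k => //; exact: leq_trans mn.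
have cvgD : (mu \o D) n @[n --> \oo] --> mu (\bigcup_(i in G) Q i).
  rewrite DU; apply: nondecreasing_cvg_mu => //.
  exact: bigcupT_measurable.
rewrite -(cvg_lim _ cvgD)//; apply: lime_le; first by apply: cvgP cvgD.
apply: nearW => n /=.
apply: (@le_trans _ _ (c%:E * eta (D n))).
  apply: (finite_vitali c0 eta_le eta_ge0 etaU mQ mQ' QQ') => i /sP[Gi _].
  exact: GQ.
by apply: lee_wpmul2l; [rewrite lee_fin|exact: eta_le].
Qed.
End vitali.

(** * Domination of the maximal function by averages over cubes *)

Section covering.
Context (R : realType) (d : nat) (alpha : R).

(** Comparable to the nu-measure of the part of sup_ball z r in the half-space,
    for z in the half-space; having the explicit formula makes the doubling
    property a computation. *)
Definition sup_ball_size (z : Rd R d) (r : R) :=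
  r ^+ (d.-1).+1 * (z.2 + r) `^ (2 * alpha + 1).

(** Take a pair (eps, z) whose average exceeds lambda. Up to constants, the lower
    bound eps^d eps^p for the measure of the half-ball divided by the upper
    bound (eps / (z_d + eps))^p for the translation is sup_ball_size z eps. *)
Lemma maximal_function_sup_ball : - 2^-1 < alpha -> (1 <= d)%N ->
  0 < nu_cst d alpha -> exists2 C : R, 0 < C &
  forall (f : Rd R d -> R), measurable_fun halfspace f ->
  forall x (lambda : R), (lambda%:E < maximal_function alpha f x)%E ->
  exists z eps, [/\ 0 < eps, halfspace z, sup_ball z eps x &
   ((lambda * sup_ball_size z eps)%:E <=
     C%:E * mass alpha f (sup_ball z eps))%E].
Proof.
move=> alpha_gt d_gt K0.
have [c c0 nu_ge] := nu_ball_origin_ge alpha_gt d_gt.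
have [C C0 trans_le] := @weinstein_translation_le R d alpha alpha_gt.
exists ((C + 1) * nu_cst d alpha / c) => [|f mf x lambda].
  by apply: divr_gt0 => //; apply: mulr_gt0 => //; lra.
move=> /ereal_sup_gt[_ [eps [z [e0 [xz z0] ->]]]].
set I := (X in `|X|%E) => lI.
exists z, eps; split => //; first exact/sup_ball_sym/edist_le_sup_ball.
have z2 : 0 < z.2 by [].
have ze : 0 < z.2 + eps by lra.
pose t := (eps / (z.2 + eps)) `^ (2 * alpha + 1).
have t0 : 0 < t by rewrite powR_gt0// divr_gt0.
pose J := mass alpha f (sup_ball z eps).
have J0 : (0 <= J)%E by exact: mass_ge0.
have IJ : (`|I| <= (C * t)%:E * J)%E.
  rewrite /J /mass -ge0_integralZl//; last 3 first.
  - apply: measurableI; first exact: measurable_sup_ball.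
    exact: measurable_halfspace.
  - apply/measurable_EFinP; apply: measurableT_comp => //.
    by apply: measurable_funS mf; [exact: measurable_halfspace|exact: subIsetr].
  - by rewrite lee_fin mulr_ge0// ltW.
  apply: abse_integral_le_support.
  - by move=> y _; rewrite -EFinM lee_fin mulr_ge0// mulr_ge0// ltW.
  - move=> y y0 _; rewrite -EFinM lee_fin normrM mulrC ler_wpM2r//.
    exact: trans_le.
  - move=> y y0 yz; rewrite weinstein_translation_out ?mulr0// => zy.
    by apply: yz.
pose v := c * (eps ^+ (d.-1).+1 * eps `^ (2 * alpha + 1)) / nu_cst d alpha.
have v0 : 0 < v.
  by apply: divr_gt0 => //; rewrite mulr_gt0// mulr_gt0 ?exprn_gt0 ?powR_gt0.
have lv : (lambda%:E <= (v^-1)%:E * ((C * t)%:E * J))%E.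
  apply: le_trans (ltW lI) _; apply: lee_pmul => //.
    by rewrite inve_ge0 measure_ge0.
  have -> : ((v^-1)%:E = v%:E^-1)%E by rewrite inver gt_eqF.
  rewrite lee_pV2 ?inE ?lee_fin ?(ltW v0)//; exact: nu_ge.
pose k := v * nu_cst d alpha / c / t.
have k0 : 0 <= k.
  by apply/ltW/divr_gt0 => //; apply: divr_gt0 => //; exact: mulr_gt0.
have kl : lambda * sup_ball_size z eps = k * lambda.
  have tE : t = eps `^ (2 * alpha + 1) / (z.2 + eps) `^ (2 * alpha + 1).
    rewrite /t powRM ?invr_ge0 ?(ltW e0) ?(ltW ze)//; congr (_ * _).
    by rewrite -[in LHS]powR_inv1 ?(ltW ze)// powRAC powR_inv1 ?powR_ge0.
  rewrite /k tE /v /sup_ball_size.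
  have : eps `^ (2 * alpha + 1) != 0 by rewrite gt_eqF// powR_gt0.
  have : (z.2 + eps) `^ (2 * alpha + 1) != 0 by rewrite gt_eqF// powR_gt0.
  move: (eps `^ _) (_ `^ _) => u w u0 w0.
  by field; rewrite u0 w0 !gt_eqF.
rewrite kl EFinM; apply: le_trans (lee_wpmul2l _ lv) _.
  by rewrite lee_fin.
rewrite -/J !muleA -!EFinM lee_wpmul2r// lee_fin.
have -> : k / v * (C * t) = C * nu_cst d alpha / c.
  by rewrite /k; field; rewrite !gt_eqF.
by rewrite ler_pM2r ?invr_gt0// ler_pM2r//; lra.
Qed.
End covering.

(** * Reduction to countably many cubes *)

Section rational_sup_balls.
Context (R : realType) (d : nat).

Let index : countType := ((d.-1).-tuple rat * rat * rat)%type.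

Definition rat_center (i : index) : Rd R d :=
  ([tuple ratr (tnth i.1.1 j) | j < d.-1], ratr i.1.2).

Definition rat_radius (i : index) : R := ratr i.2.

(** The centre is taken higher than z so as to stay in the half-space, and the
    radius is large enough for the new cube to contain sup_ball z eps. *)
Lemma rat_sup_ball_approx (z : Rd R d) (eps : R) : 0 < eps ->
  exists i : index, [/\ sup_ball (rat_center i) eps z,
    z.2 < (rat_center i).2 < z.2 + eps & 2 * eps < rat_radius i < 3 * eps].
Proof.
move=> e0.
have /choice[q qz] : forall j : 'I_(d.-1), exists q : rat,
    `|ratr q - tnth z.1 j| <= eps.
  move=> j; have zj : tnth z.1 j - eps < tnth z.1 j + eps by lra.
  have [q] := rat_in_itvoo zj.
  rewrite in_itv/= => /andP[q1 q2].
  by exists q; rewrite ler_norml; apply/andP; split; lra.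
have ze : z.2 < z.2 + eps by lra.
have [u] := rat_in_itvoo ze.
rewrite in_itv/= => uz.
have ee : 2 * eps < 3 * eps by lra.
have [r] := rat_in_itvoo ee.
rewrite in_itv/= => re.
exists ([tuple q j | j < d.-1], u, r); split => //.
split => [j|] /=; first by rewrite !tnth_mktuple.
by move: uz => /andP[u1 u2]; rewrite ler_norml; apply/andP; split; lra.
Qed.

End rational_sup_balls.

Section rational_covering.
Context (R : realType) (d : nat) (alpha : R).
Local Notation p := (2 * alpha + 1).

(** The tripled rational cube has half-side less than 9 eps and reaches at most
    to the height z_d + 10 eps, so its nu-measure is at most
    (18 eps)^d (10 (z_d + eps))^p divided by the constant of nu. *)
Lemma maximal_function_covering : - 2^-1 < alpha -> (1 <= d)%N ->
  0 < nu_cst d alpha -> exists2 c : R, 0 < c &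
  forall (f : Rd R d -> R), measurable_fun halfspace f ->
  forall x (lambda : R), 0 < lambda ->
  (lambda%:E < maximal_function alpha f x)%E ->
  exists2 i, sup_ball (rat_center R i) (rat_radius R i) x &
   (nu alpha (sup_ball (rat_center R i) (3 * rat_radius R i)) <=
     (c / lambda)%:E
       * mass alpha f (sup_ball (rat_center R i) (rat_radius R i)))%E.
Proof.
move=> alpha_gt d_gt K0.
have p0 : 0 <= p by lra.
have [C C0 max_le] := maximal_function_sup_ball alpha_gt d_gt K0.
pose M := 18 ^+ (d.-1).+1 * 10 `^ p / nu_cst d alpha.
have M0 : 0 < M by apply: divr_gt0 => //; rewrite mulr_gt0 ?powR_gt0 ?exprn_gt0.
exists (M * C) => [|f mf x lambda l0 /(max_le _ mf)]; first exact: mulr_gt0.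
move=> [z [eps [e0 z0 xz avg]]].
have z2 : 0 < z.2 by [].
have [i [iz /andP[z1 z3] /andP[r1 r2]]] := rat_sup_ball_approx z e0.
have sub : sup_ball z eps `<=` sup_ball (rat_center R i) (rat_radius R i).
  move=> y zy; apply: sup_ball_le (sup_ball_trans iz zy).
  by lra.
exists i; first exact: sub.
apply: le_trans (nu_sup_ball_le _ alpha_gt _) _; first by lra.
apply: (@le_trans _ _ (M * sup_ball_size alpha z eps)%:E).
  rewrite lee_fin.
  rewrite [leRHS](_ : _ = (18 * eps) ^+ (d.-1).+1 *
      ((10 * (z.2 + eps)) `^ p / nu_cst d alpha)); last first.
    rewrite /M /sup_ball_size exprMn powRM//; last by lra.
    by ring.
  apply: ler_pM.
  - by rewrite exprn_ge0//; lra.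
  - by rewrite divr_ge0 ?powR_ge0// ltW.
  - by rewrite lerXn2r ?nnegrE//; lra.
  - rewrite ler_pM2r ?invr_gt0//.
    by apply: ge0_ler_powR; rewrite ?nnegrE//; lra.
rewrite (_ : M * _ = M / lambda * (lambda * sup_ball_size alpha z eps));
  last by field; rewrite gt_eqF.
rewrite EFinM.
apply: (@le_trans _ _
    ((M / lambda)%:E * (C%:E * mass alpha f (sup_ball z eps)))%E).
  by apply: lee_wpmul2l; rewrite ?lee_fin// ltW// divr_gt0.
rewrite muleA -EFinM mulrAC; apply: lee_wpmul2l; last exact: mass_le.
by rewrite lee_fin ltW// divr_gt0// mulr_gt0.
Qed.

End rational_covering.

(** * The weak type inequality *)

Theorem theorem3p1 (R : realType) (d : nat) (alpha : R) :
  (2 <= d)%N -> - 2^-1 < alpha ->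
  exists2 c : R, 0 < c &
    forall f : Rd R d -> R,
      (@nu R d alpha).-integrable halfspace (EFin \o f) ->
    forall lambda : R, 0 < lambda ->
      (nu alpha [set x : Rd R d |
                  halfspace x /\ lambda%:E < maximal_function alpha f x]
       <= c%:E * (norm1 alpha f / lambda%:E))%E.
Proof.
move=> d2 alpha_gt; have d1 : (1 <= d)%N by exact: ltnW.
have norm1_ge0 f : (0 <= @norm1 R d alpha f)%E.
  by apply: integral_ge0 => y _; rewrite lee_fin.
(* A vanishing constant would make the density of nu equal to 0. *)
have [K0|K_neq0] := eqVneq (nu_cst d alpha) 0.
  exists 1 => // f _ lambda l0.
  by rewrite nu_eq0// mul1e mule_ge0// inve_ge0 lee_fin ltW.
have K0 : 0 < nu_cst d alpha by rewrite lt_def K_neq0 nu_cst_ge0.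
have [c c0 cover] := maximal_function_covering alpha_gt d1 K0.
exists c => // f /measurable_int/measurable_EFinP mf lambda l0.
pose Q i := sup_ball (rat_center R (d := d) i) (rat_radius R (d := d) i).
pose Q' i := sup_ball (rat_center R (d := d) i) (3 * rat_radius R (d := d) i).
pose G := [set i | (nu alpha (Q' i) <= (c / lambda)%:E * mass alpha f (Q i))%E].
apply: (@le_trans _ _ (nu alpha (\bigcup_(i in G) Q i))).
  by apply: le_nu => x [[_ /(cover _ mf _ _ l0)[i Qix Gi]] _]; exists i.
rewrite inver gt_eqF// [(norm1 _ _ * _)%E]muleC muleA -EFinM.
rewrite (_ : norm1 alpha f = mass alpha f setT); last by rewrite /mass setTI.
apply: (countable_vitali (Q' := Q') (rad := @rat_radius R d)) => //.
- by rewrite divr_ge0// ltW.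
- by move=> A B; exact: mass_le.
- by move=> A; exact: mass_ge0.
- by move=> A B mA mB AB; rewrite massU.
- by move=> i; exact: measurable_sup_ball.
- by move=> i; exact: measurable_sup_ball.
move=> i j rij [x [Qix Qjx]] y Qjy.
apply: sup_ball_le (sup_ball_trans (sup_ball_trans Qix (sup_ball_sym Qjx)) Qjy).
lra.
Qed.
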